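(* Let $G_1$ and $G_2$ be finite groups. If $L(G_1)\cong L(G_2)$ as lattices, then $\mathcal I(G_1)\cong\mathcal I(G_2)$ as graphs.
   Context: For a finite group $G$, the inclusion graph of subgroups $\mathcal I(G)$ is the simple graph whose vertices are the proper subgroups of $G$, where ''proper'' means different from both the trivial subgroup and $G$ itself; two distinct vertices $H,K$ are adjacent if and only if $H\subset K$ or $K\subset H$. $L(G)$ is the lattice of all subgroups of $G$. *)

(* Defs.v *)
From HB Require Import structures.
From mathcomp Require Import all_boot all_order all_fingroup.
Set Implicit Arguments.
Unset Strict Implicit.
Unset Printing Implicit Defensive.

Import Order.TTheory GroupScope.

(* L(G): the finite lattice of all subgroups of G, ordered by inclusion, with
   meet H :&: K and join H <*> K. *)

Definition subgroup_lattice (gT : finGroupType) (G : {group gT}) : Type :=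
  {H : {group gT} | H \subset G}.

HB.instance Definition _ (gT : finGroupType) (G : {group gT}) :=
  Finite.copy (subgroup_lattice G) {H : {group gT} | H \subset G}.

Fact subgroup_display : Order.disp_t. Proof. exact: Order.Disp tt tt. Qed.

Definition subgroup_le (gT : finGroupType) (G : {group gT}) :
    rel (subgroup_lattice G) := fun H K => val H \subset val K.

Lemma subgroup_le_refl (gT : finGroupType) (G : {group gT}) :
  reflexive (@subgroup_le gT G).
Proof. by move=> H; apply: subxx. Qed.

Lemma subgroup_le_anti (gT : finGroupType) (G : {group gT}) :
  antisymmetric (@subgroup_le gT G).
Proof.
by move=> H K HK; apply/val_inj/val_inj/eqP; rewrite eqEsubset; apply: HK.
Qed.

Lemma subgroup_le_trans (gT : finGroupType) (G : {group gT}) :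
  transitive (@subgroup_le gT G).
Proof. by move=> K H M; apply: subset_trans. Qed.

HB.instance Definition _ (gT : finGroupType) (G : {group gT}) :=
  Order.Le_isPOrder.Build subgroup_display (subgroup_lattice G)
    (@subgroup_le_refl gT G) (@subgroup_le_anti gT G) (@subgroup_le_trans gT G).

Lemma subgroup_meet_subproof (gT : finGroupType) (G : {group gT})
  (H K : subgroup_lattice G) : (val H :&: val K)%G \subset G.
Proof. exact: subset_trans (subsetIl _ _) (valP H). Qed.

Lemma subgroup_join_subproof (gT : finGroupType) (G : {group gT})
  (H K : subgroup_lattice G) : (val H <*> val K)%G \subset G.
Proof. by rewrite join_subG (valP H) (valP K). Qed.

Definition subgroup_meet (gT : finGroupType) (G : {group gT})
    (H K : subgroup_lattice G) : subgroup_lattice G :=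
  Sub (val H :&: val K)%G (subgroup_meet_subproof H K).

Definition subgroup_join (gT : finGroupType) (G : {group gT})
    (H K : subgroup_lattice G) : subgroup_lattice G :=
  Sub (val H <*> val K)%G (subgroup_join_subproof H K).

Lemma subgroup_meetP (gT : finGroupType) (G : {group gT})
  (H K M : subgroup_lattice G) :
  (H <= subgroup_meet K M)%O = (H <= K)%O && (H <= M)%O.
Proof. exact: subsetI. Qed.

Lemma subgroup_joinP (gT : finGroupType) (G : {group gT})
  (H K M : subgroup_lattice G) :
  (subgroup_join H K <= M)%O = (H <= M)%O && (K <= M)%O.
Proof. exact: join_subG. Qed.

HB.instance Definition _ (gT : finGroupType) (G : {group gT}) :=
  Order.POrder_MeetJoin_isLattice.Build subgroup_display (subgroup_lattice G)
    (@subgroup_meetP gT G) (@subgroup_joinP gT G).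

Definition lattice_isomorphic (d1 d2 : Order.disp_t)
    (L1 : latticeType d1) (L2 : latticeType d2) : Prop :=
  exists f : {lmorphism L1 -> L2}, bijective f.

Record sgraph : Type := SGraph {
  vertex : finType;
  adj : rel vertex;
  adj_sym : symmetric adj;
  adj_irrefl : irreflexive adj }.

Definition graph_isomorphic (X Y : sgraph) : Prop :=
  exists2 f : vertex X -> vertex Y,
    bijective f & forall u v, adj (f u) (f v) = adj u v.

(* "Proper" excludes the trivial subgroup as well as G. *)
Definition proper_subgroup (gT : finGroupType) (G : {group gT}) : finType :=
  {H : {group gT} | [&& H \subset G, H :!=: 1 & H :!=: G]}.

Definition inclusion_adj (gT : finGroupType) (G : {group gT}) :
    rel (proper_subgroup G) :=
  fun H K => (H != K) && ((val H \subset val K) || (val K \subset val H)).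

Lemma inclusion_adj_sym (gT : finGroupType) (G : {group gT}) :
  symmetric (@inclusion_adj gT G).
Proof. by move=> H K; rewrite /inclusion_adj eq_sym orbC. Qed.

Lemma inclusion_adj_irrefl (gT : finGroupType) (G : {group gT}) :
  irreflexive (@inclusion_adj gT G).
Proof. by move=> H; rewrite /inclusion_adj eqxx. Qed.

Definition inclusion_graph (gT : finGroupType) (G : {group gT}) : sgraph :=
  SGraph (@inclusion_adj_sym gT G) (@inclusion_adj_irrefl gT G).

(* Main.v *)
Require Import Defs.
From mathcomp Require Import all_boot all_order all_fingroup.

(** The inclusion graph is read off the order of L(G): its vertices are the
    elements of L(G) that are neither least nor greatest, and adjacency is
    strict comparability. A bijective lattice morphism f is an isomorphism of
    orders, because x <= y means that the meet of x and y is x, and f preserves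
    meets and is injective ([lmorphism_le_mono]). Being different from the
    bottom 1 and from the top G can be said with the order alone
    ([properE_order]), so f and its inverse restrict to mutually inverse maps
    between the vertex sets ([proper_image]), and these respect adjacency. *)

Set Implicit Arguments.
Unset Strict Implicit.
Unset Printing Implicit Defensive.

Import Order.TTheory GroupScope.

Lemma lmorphism_le_mono (d1 d2 : Order.disp_t) (L1 : latticeType d1)
    (L2 : latticeType d2) (f : {lmorphism L1 -> L2}) :
  injective f -> {mono f : x y / (x <= y)%O}.
Proof. by move=> f_inj x y; rewrite !leEmeet -omorphI (inj_eq f_inj). Qed.

(** The bottom of L(G) is the only element below everything, and the top the
    only one above everything. Quantifying over all of L(G), instead of naming
    1 and G, gives a condition that order embeddings visibly preserve. *)
Lemma properE_order (gT : finGroupType) (G : {group gT})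
    (H : subgroup_lattice G) :
  [&& val H \subset G, val H :!=: 1 & val H :!=: G] <->
  (exists K, ~~ (H <= K)%O) /\ (exists K, ~~ (K <= H)%O).
Proof.
rewrite (valP H) /=; split=> [/andP[ntH neqHG] | [[K nHK] [M nMH]]].
  split.
    by exists (Sub 1%G (sub1G G)); rewrite [(_ <= _)%O]subG1.
  exists (Sub G (subxx G)).
  by apply: contra neqHG => sGH; rewrite eqEsubset (valP H).
apply/andP; split.
  apply: contra nHK => /eqP H1.
  by suff: val H \subset val K by []; rewrite H1 sub1G.
apply: contra nMH => /eqP HG.
by suff: val M \subset val H by []; rewrite HG (valP M).
Qed.

Definition to_lattice (gT : finGroupType) (G : {group gT})
    (H : proper_subgroup G) : subgroup_lattice G :=
  Sub (val H) (proj1 (andP (valP H))).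

(** The images under [f] of the two witnesses of [properE_order] for H are
    witnesses for the image of H. *)
Lemma proper_image (gT1 gT2 : finGroupType)
    (G1 : {group gT1}) (G2 : {group gT2})
    (f : subgroup_lattice G1 -> subgroup_lattice G2)
    (f_mono : {mono f : x y / (x <= y)%O}) (H : proper_subgroup G1) :
  [&& val (f (to_lattice H)) \subset G2, val (f (to_lattice H)) :!=: 1
    & val (f (to_lattice H)) :!=: G2].
Proof.
have [[K nHK] [M nMH]] := (properE_order (to_lattice H)).1 (valP H).
by apply/properE_order; split; [exists (f K) | exists (f M)]; rewrite f_mono.
Qed.

Definition restrict_proper (gT1 gT2 : finGroupType)
    (G1 : {group gT1}) (G2 : {group gT2})
    (f : subgroup_lattice G1 -> subgroup_lattice G2)
    (f_mono : {mono f : x y / (x <= y)%O}) (H : proper_subgroup G1) :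
  proper_subgroup G2 := Sub (val (f (to_lattice H))) (proper_image f_mono H).

Lemma to_lattice_restrict (gT1 gT2 : finGroupType)
    (G1 : {group gT1}) (G2 : {group gT2})
    (f : subgroup_lattice G1 -> subgroup_lattice G2)
    (f_mono : {mono f : x y / (x <= y)%O}) (H : proper_subgroup G1) :
  to_lattice (restrict_proper f_mono H) = f (to_lattice H).
Proof. exact: val_inj. Qed.

Lemma restrict_proper_can (gT1 gT2 : finGroupType)
    (G1 : {group gT1}) (G2 : {group gT2})
    (f : subgroup_lattice G1 -> subgroup_lattice G2)
    (g : subgroup_lattice G2 -> subgroup_lattice G1)
    (f_mono : {mono f : x y / (x <= y)%O})
    (g_mono : {mono g : x y / (x <= y)%O}) :
  cancel f g -> cancel (restrict_proper f_mono) (restrict_proper g_mono).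
Proof.
by move=> fK H; apply: val_inj; rewrite /= to_lattice_restrict fK.
Qed.

Theorem theorem2p2 (gT1 gT2 : finGroupType)
    (G1 : {group gT1}) (G2 : {group gT2}) :
  lattice_isomorphic (subgroup_lattice G1) (subgroup_lattice G2) ->
  graph_isomorphic (inclusion_graph G1) (inclusion_graph G2).
Proof.
case=> f [g fK gK].
have f_mono := lmorphism_le_mono (can_inj fK).
have g_mono := can_mono gK f_mono.
have phiK := restrict_proper_can f_mono g_mono fK.
exists (restrict_proper f_mono).
  exact: Bijective phiK (restrict_proper_can g_mono f_mono gK).
move=> H K; rewrite /= /inclusion_adj (inj_eq (can_inj phiK)).
congr (_ && (_ || _)).
  exact: (f_mono (to_lattice H) (to_lattice K)).
exact: (f_mono (to_lattice K) (to_lattice H)).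
Qed.
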